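(* Let $(K_1,\leq_1)$ and $(K_2,\leq_2)$ be smooth classes in disjoint languages $\mathcal{L}_1$, $\mathcal{L}_2$ with generics $M_1$, $M_2$ respectively. Suppose the merge $(K_1\circledast K_2,\leq_* )$ has a generic $M^*$. Moreover, assume that $M^*|_{\mathcal{L}_1}\cong M_1$ and $M^*|_{\mathcal{L}_2}\cong M_2$. If $M_1$ and $M_2$ are atomic, then the merged generic $M^*$ is atomic.
   Context: All languages are countable and relational. Smooth class. A pair $(K,\leq)$ is a smooth class in the language $\mathcal{L}$ if $K$ is a class of finite $\mathcal{L}$-structures closed under isomorphism and $\leq$ is a binary relation on $K$ such that: (1) $\leq$ is transitive and $A\leq B$ implies $A\subseteq B$ (substructure); (2) for every $B\in K$ and every enumeration $\overline{b}=(b_1,\dots,b_n)$ of $B$ there is a (possibly infinite) set $\Phi_{\overline{b}}(\overline{x})$, $|\overline{x}|=n$, of universal $\mathcal{L}$-formulas containing the atomic diagram of $B$ (w.r.t. $\overline{b}$) such that for all $C\in K$ with $B\subseteq C$: $B\leq C\Leftrightarrow C\models\Phi_{\overline{b}}(\overline{b})$; (3) if $f:A\to B$ is an isomorphism of members of $K$ and $\overline{a}$ enumerates $A$, then $\Phi_{\overline{a}}=\Phi_{f(\overline{a})}$; (4) $\emptyset\in K$ and $\emptyset\leq A$ for all $A\in K$. For an $\mathcal{L}$-structure $M$ and $A\in K$ with $A\subseteq M$, write $A\leq M$ iff $M\models\Phi_{\overline{a}}(\overline{a})$ for every enumeration $\overline{a}$ of $A$. Generic. An $\mathcal{L}$-structure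 $M$ is a generic for $(K,\leq)$ if (1) $M=\bigcup_{i\in\omega}A_i$ with $A_i\in K$ and $A_i\leq A_j$ for $i\leq j$; and (2) whenever $A,B\in K$, $A\leq M$ and $A\leq B$, there is an embedding $f:B\to M$ with $f|_A=\mathrm{id}_A$ and $f(B)\leq M$. Merge. $(K_1\circledast K_2,\leq_* )$ is the smooth class in $\mathcal{L}_1\cup\mathcal{L}_2$ consisting of the finite structures $A$ with $A|_{\mathcal{L}_i}\in K_i$ for $i=1,2$, with $A\leq_*B$ iff $A|_{\mathcal{L}_i}\leq_iB|_{\mathcal{L}_i}$ for $i=1,2$. For $A\in K_1\circledast K_2$ with enumeration $\overline{a}$, the associated set of universal formulas is $\Phi^*_{\overline{a}}=\Phi^1_{\overline{a}}\cup\Phi^2_{\overline{a}}$, where $\Phi^i_{\overline{a}}$ is the set associated with $A|_{\mathcal{L}_i}$ in $(K_i,\leq_i)$. A structure is atomic if the complete type of each of its finite tuples is isolated by a single formula modulo its theory. *)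

(* Defs.v *)
From mathcomp Require Import all_boot.

Set Implicit Arguments.
Unset Strict Implicit.
Unset Printing Implicit Defensive.

(* Relation symbols have positive arity, so that there is only one empty
   structure in each language. *)
Record language := Language {
  symbol :> countType;
  arity : symbol -> nat;
  arity_gt0 : forall R : symbol, 0 < arity R }.

(* Structures may be empty; n-tuples are functions on 'I_n. *)
Record structure (L : language) := Structure {
  carrier :> Type;
  interp : forall R : L, ('I_(arity R) -> carrier) -> Prop }.

(* [formula L n] is the type of first-order L-formulas whose free variables are
   among the n variables indexed by 'I_n (the only terms of a relational
   language are variables).  The body of a quantifier has the bound variable
   at index 0 and the others shifted by one. *)
Inductive formula (L : language) : nat -> Type :=
| FBot n : formula L n
| FEq n (i j : 'I_n) : formula L n
| FRel n (R : L) (t : 'I_(arity R) -> 'I_n) : formula L n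
| FImp n (phi psi : formula L n) : formula L n
| FAll n (phi : formula L n.+1) : formula L n.

Arguments FBot {L n}.
Arguments FEq {L n} i j.
Arguments FRel {L n} R t.

Definition FNot (L : language) n (phi : formula L n) : formula L n :=
  FImp phi FBot.

Definition vcons (T : Type) n (x : T) (v : 'I_n -> T) : 'I_n.+1 -> T :=
  fun i => if unlift ord0 i is Some j then v j else x.

Fixpoint sat (L : language) (M : structure L) n (phi : formula L n) :
    ('I_n -> M) -> Prop :=
  match phi in formula _ n return ('I_n -> M) -> Prop with
  | FBot _ => fun _ => False
  | FEq _ i j => fun v => v i = v j
  | FRel _ R t => fun v => interp (v \o t)
  | FImp _ phi psi => fun v => sat phi v -> sat psi v
  | FAll _ phi => fun v => forall x : M, sat phi (vcons x v)
  end.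

Definition is_atom (L : language) n (phi : formula L n) : bool :=
  match phi with FEq _ _ _ | FRel _ _ _ => true | _ => false end.

Fixpoint quantifier_free (L : language) n (phi : formula L n) : bool :=
  match phi with
  | FImp _ phi psi => quantifier_free phi && quantifier_free psi
  | FAll _ _ => false
  | _ => true
  end.

Fixpoint universal (L : language) n (phi : formula L n) : bool :=
  match phi with
  | FAll _ phi => universal phi
  | phi => quantifier_free phi
  end.

Definition sentence (L : language) := formula L 0.

Definition novar (T : Type) : 'I_0 -> T :=
  fun i => False_rect T (notF (ltn_ord i)).

Definition theory (L : language) (M : structure L) : sentence L -> Prop :=
  fun phi => sat phi (@novar M).

Definition model_of (L : language) (T : sentence L -> Prop) (N : structure L) :=
  forall phi, T phi -> sat phi (@novar N).

Definition complete_type (L : language) (M : structure L) n (a : 'I_n -> M) :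
    formula L n -> Prop :=
  fun psi => sat psi a.

Definition isolates (L : language) (T : sentence L -> Prop) n
    (phi : formula L n) (p : formula L n -> Prop) :=
  p phi /\
  forall psi, p psi ->
    forall N, model_of T N -> forall b : 'I_n -> N, sat phi b -> sat psi b.

Definition atomic (L : language) (M : structure L) :=
  forall n (a : 'I_n -> M),
    exists phi : formula L n, isolates (theory M) phi (complete_type a).

(* An inclusion of a structure A in a structure B is rendered
   by an embedding A -> B. *)

Definition preserves (L : language) (A B : structure L) (f : A -> B) :=
  forall (R : L) (t : 'I_(arity R) -> A), interp t <-> interp (f \o t).

Definition embedding (L : language) (A B : structure L) (f : A -> B) :=
  injective f /\ preserves f.

Definition isomorphism (L : language) (A B : structure L) (f : A -> B) :=
  bijective f /\ preserves f.

Definition isomorphic (L : language) (A B : structure L) :=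
  exists f : A -> B, isomorphism f.

Definition enumeration (T : Type) n (a : 'I_n -> T) := bijective a.

Definition finite (T : Type) := exists n (a : 'I_n -> T), enumeration a.

Definition atomic_diagram (L : language) (A : structure L) n (a : 'I_n -> A) :
    formula L n -> Prop :=
  fun phi => exists2 theta, is_atom theta &
    sat theta a /\ phi = theta \/ ~ sat theta a /\ phi = FNot theta.

(* The data of a smooth class: the class K, the relation f(A) <= B for
   f : A -> B, and the sets Phi_a of formulas.  The latter are part of the data
   because A <= M, for M outside K, is defined from them; only their values at
   enumerations of members of K matter. *)
Record preclass (L : language) := Preclass {
  in_class : structure L -> Prop;
  strong : forall A B : structure L, (A -> B) -> Prop;
  Phi : forall (A : structure L) n, ('I_n -> A) -> formula L n -> Prop }.

Record smooth (L : language) (K : preclass L) : Prop := Smooth {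
  smooth_finite : forall A : structure L, in_class K A -> finite A;
  smooth_iso : forall A B : structure L,
    isomorphic A B -> in_class K A -> in_class K B;
  strong_mem : forall (A B : structure L) (f : A -> B),
    strong K f -> in_class K A /\ in_class K B;
  strong_trans : forall (A B C : structure L) (f : A -> B) (g : B -> C),
    strong K f -> strong K g -> strong K (g \o f);
  strong_embedding : forall (A B : structure L) (f : A -> B),
    strong K f -> embedding f;
  Phi_universal : forall (B : structure L) n (b : 'I_n -> B),
    in_class K B -> enumeration b -> forall phi, Phi K b phi -> universal phi;
  Phi_diagram : forall (B : structure L) n (b : 'I_n -> B),
    in_class K B -> enumeration b ->
    forall phi, atomic_diagram b phi -> Phi K b phi;
  Phi_strong : forall (B : structure L) n (b : 'I_n -> B),
    in_class K B -> enumeration b ->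
    forall (C : structure L) (f : B -> C), in_class K C -> embedding f ->
    (strong K f <-> forall phi, Phi K b phi -> sat phi (f \o b));
  Phi_iso : forall (A B : structure L) (f : A -> B) n (a : 'I_n -> A),
    in_class K A -> in_class K B -> isomorphism f -> enumeration a ->
    forall phi, Phi K a phi <-> Phi K (f \o a) phi;
  mem_empty : forall E : structure L, (E -> False) -> in_class K E;
  strong_empty : forall (E A : structure L) (f : E -> A),
    (E -> False) -> in_class K A -> strong K f }.

(* f(A) <= M, for A in K and an arbitrary structure M *)
Definition strong_in (L : language) (K : preclass L) (A M : structure L)
    (f : A -> M) :=
  [/\ in_class K A, embedding f &
      forall n (a : 'I_n -> A), enumeration a ->
        forall phi, Phi K a phi -> sat phi (f \o a)].

Definition strong_chain_union (L : language) (K : preclass L)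
    (M : structure L) :=
  exists (A : nat -> structure L) (e : forall i, A i -> M),
    [/\ forall i, in_class K (A i),
        forall i, embedding (e i),
        forall x : M, exists i (y : A i), e i y = x &
        forall i j, i <= j ->
          exists2 f : A i -> A j, strong K f & forall y, e j (f y) = e i y].

Definition generic (L : language) (K : preclass L) (M : structure L) :=
  strong_chain_union K M /\
  forall (A B : structure L) (e : A -> M) (i : A -> B),
    in_class K A -> in_class K B -> strong_in K e -> strong K i ->
    exists2 f : B -> M, strong_in K f & forall x, f (i x) = e x.

(* The union of two disjoint languages has as symbols the disjoint sum of
   their types of symbols. *)

Section Merge.

Variables L1 L2 : language.

Definition union_arity (R : L1 + L2) : nat :=
  match R with inl R1 => arity R1 | inr R2 => arity R2 end.

Lemma union_arity_gt0 R : 0 < union_arity R.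
Proof. by case: R => R; apply: arity_gt0. Qed.

Definition lang_union : language := Language union_arity_gt0.

Definition sym1 (R : L1) : lang_union := inl R.
Definition sym2 (R : L2) : lang_union := inr R.

Definition reduct1 (M : structure lang_union) : structure L1 :=
  @Structure L1 M (fun R => @interp _ M (sym1 R)).

Definition reduct2 (M : structure lang_union) : structure L2 :=
  @Structure L2 M (fun R => @interp _ M (sym2 R)).

Fixpoint lift1 n (phi : formula L1 n) : formula lang_union n :=
  match phi in formula _ n return formula lang_union n with
  | FBot _ => FBot
  | FEq _ i j => FEq i j
  | FRel _ R t => FRel (sym1 R) t
  | FImp _ phi psi => FImp (lift1 phi) (lift1 psi)
  | FAll _ phi => FAll (lift1 phi)
  end.

Fixpoint lift2 n (phi : formula L2 n) : formula lang_union n :=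
  match phi in formula _ n return formula lang_union n with
  | FBot _ => FBot
  | FEq _ i j => FEq i j
  | FRel _ R t => FRel (sym2 R) t
  | FImp _ phi psi => FImp (lift2 phi) (lift2 psi)
  | FAll _ phi => FAll (lift2 phi)
  end.

Definition merge (K1 : preclass L1) (K2 : preclass L2) : preclass lang_union :=
  {| in_class := fun A => in_class K1 (reduct1 A) /\ in_class K2 (reduct2 A);
     strong := fun A B f =>
       strong K1 (A := reduct1 A) (B := reduct1 B) f /\
       strong K2 (A := reduct2 A) (B := reduct2 B) f;
     Phi := fun A n a phi =>
       (exists2 phi1, Phi K1 (A := reduct1 A) a phi1 & phi = lift1 phi1) \/
       (exists2 phi2, Phi K2 (A := reduct2 A) a phi2 & phi = lift2 phi2) |}.

Lemma sat_lift1 (M : structure lang_union) n (phi : formula L1 n)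
    (v : 'I_n -> M) :
  sat (lift1 phi) v <-> sat (M := reduct1 M) phi v.
Proof.
elim: phi v => //= {}n => [phi IH psi IH'|phi IH] v.
  by split=> H /IH /H /IH'.
by split=> H x; apply/IH.
Qed.

Lemma sat_lift2 (M : structure lang_union) n (phi : formula L2 n)
    (v : 'I_n -> M) :
  sat (lift2 phi) v <-> sat (M := reduct2 M) phi v.
Proof.
elim: phi v => //= {}n => [phi IH psi IH'|phi IH] v.
  by split=> H /IH /H /IH'.
by split=> H x; apply/IH.
Qed.

Lemma quantifier_free_lift1 n (phi : formula L1 n) :
  quantifier_free (lift1 phi) = quantifier_free phi.
Proof. by elim: phi => //= {}n phi -> psi ->. Qed.

Lemma quantifier_free_lift2 n (phi : formula L2 n) :
  quantifier_free (lift2 phi) = quantifier_free phi.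
Proof. by elim: phi => //= {}n phi -> psi ->. Qed.

Lemma universal_lift1 n (phi : formula L1 n) :
  universal (lift1 phi) = universal phi.
Proof. by elim: phi => //= *; rewrite !quantifier_free_lift1. Qed.

Lemma universal_lift2 n (phi : formula L2 n) :
  universal (lift2 phi) = universal phi.
Proof. by elim: phi => //= *; rewrite !quantifier_free_lift2. Qed.

Lemma preserves_merge (A B : structure lang_union) (f : A -> B) :
  preserves f <->
  preserves (A := reduct1 A) (B := reduct1 B) f /\
  preserves (A := reduct2 A) (B := reduct2 B) f.
Proof.
split=> [H|[H1 H2]].
  by split=> R t; [apply: (H (sym1 R)) | apply: (H (sym2 R))].
by case=> R t; [apply: H1 | apply: H2].
Qed.

Lemma merge_smooth (K1 : preclass L1) (K2 : preclass L2) :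
  smooth K1 -> smooth K2 -> smooth (merge K1 K2).
Proof.
move=> S1 S2; split=> /=.
- by move=> A [/(smooth_finite S1)].
- move=> A B [f [bf /preserves_merge [p1 p2]]] [m1 m2].
  split; [apply: (smooth_iso S1) m1 | apply: (smooth_iso S2) m2];
  by exists f.
- move=> A B f [/(strong_mem S1) [? ?] /(strong_mem S2) [? ?]].
  by split; split.
- move=> A B C f g [f1 f2] [g1 g2].
  by split; [apply: (strong_trans S1) f1 g1 | apply: (strong_trans S2) f2 g2].
- move=> A B f [/(strong_embedding S1) [i1 p1] /(strong_embedding S2) [_ p2]].
  by split=> //; apply/preserves_merge.
- move=> B n b [m1 m2] eb phi [] [psi H ->].
    by rewrite universal_lift1; apply: (Phi_universal S1) H.
  by rewrite universal_lift2; apply: (Phi_universal S2) H.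
- move=> B n b [m1 m2] eb phi [theta].
  move: b eb phi; case: theta => // {}n.
    move=> i j b eb phi _ H; left.
    exists (if phi is FImp _ _ _ then FNot (FEq i j) else FEq i j).
      apply: (Phi_diagram S1) => //; exists (FEq i j) => //.
      by case: H => -[? ->]; [left | right].
    by case: H => -[? ->].
  case=> R t b eb phi _ H; [left | right].
    exists (if phi is FImp _ _ _ then FNot (FRel R t) else FRel R t).
      apply: (Phi_diagram S1) => //; exists (FRel R t) => //.
      by case: H => -[? ->]; [left | right].
    by case: H => -[? ->].
  exists (if phi is FImp _ _ _ then FNot (FRel R t) else FRel R t).
    apply: (Phi_diagram S2) => //; exists (FRel R t) => //.
    by case: H => -[? ->]; [left | right].
  by case: H => -[? ->].
- move=> B n b [m1 m2] eb C f [c1 c2] [inj /preserves_merge [p1 p2]].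
  have E1 := Phi_strong S1 m1 eb c1 (conj inj p1).
  have E2 := Phi_strong S2 m2 eb c2 (conj inj p2).
  split=> [[/E1 H1 /E2 H2] phi [] [psi H ->]|H].
  + by apply/sat_lift1; apply: H1.
  + by apply/sat_lift2; apply: H2.
  split; [apply/E1 | apply/E2] => psi Hpsi.
  + by apply/(@sat_lift1 C); apply: H; left; exists psi.
  + by apply/(@sat_lift2 C); apply: H; right; exists psi.
- move=> A B f n a [a1 a2] [b1 b2] [bf /preserves_merge [p1 p2]] ea phi.
  have E1 := Phi_iso S1 a1 b1 (conj bf p1) ea.
  have E2 := Phi_iso S2 a2 b2 (conj bf p2) ea.
  by split=> -[] [psi H ->]; [left|right|left|right]; exists psi => //;
    [apply/E1|apply/E2|apply/E1|apply/E2].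
- by move=> E HE; split; [apply: (mem_empty S1) | apply: (mem_empty S2)].
- by move=> E A f HE [m1 m2]; split;
    [apply: (strong_empty S1) | apply: (strong_empty S2)].
Qed.

End Merge.

(* Main.v *)
From mathcomp Require Import all_boot.
From Stdlib Require Import Classical FunctionalExtensionality.
Require Import Defs.

Set Implicit Arguments.
Unset Strict Implicit.
Unset Printing Implicit Defensive.

(** The merged generic M is homogeneous over its strong finite substructures:
    two strong embeddings e, e' : A -> M of a member A of the class are
    back-and-forth equivalent, hence satisfy the same formulas
    ([generic_homogeneous]).  So the complete type of a tuple enumerating a
    finite A <= M is determined, inside M, by the isomorphism type of A
    together with the fact that A is strong in M.  Both are expressed by the
    formulas of Phi^1_a and Phi^2_a, that is, by the L1-type and the L2-type of
    the tuple ([strong_in_same_type]).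

    The reducts of M are atomic, being isomorphic to M1 and M2, so each of
    these two types is isolated by one formula, phi1 and phi2 say.  A tuple of M
    satisfying phi1 /\ phi2 has the L1-type and the L2-type of the original
    one, hence enumerates a strong copy of A, hence has the same type in
    L1 + L2 by homogeneity.  Thus phi1 /\ phi2 isolates this type.

    An arbitrary finite tuple lies in some strong A, because M is the union of
    a strong chain ([strong_cover]); it is a part of a tuple that enumerates A
    with repetitions, and the remaining coordinates are removed by existential
    quantification ([isolated_rshift]). *)

(** * Semantics of formulas *)

Lemma vcons_comp (S T : Type) (f : S -> T) n (x : S) (v : 'I_n -> S) :
  f \o vcons x v = vcons (f x) (f \o v).
Proof.
by apply: functional_extensionality => i; rewrite /vcons /=; case: unlift.
Qed.

Lemma vcons0 (T : Type) n (x : T) (v : 'I_n -> T) : vcons x v ord0 = x.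
Proof. by rewrite /vcons unlift_none. Qed.

Lemma vcons_lift (T : Type) n (x : T) (v : 'I_n -> T) :
  vcons x v \o lift ord0 = v.
Proof. by apply: functional_extensionality => i; rewrite /vcons /= liftK. Qed.

Lemma vcons_eta (T : Type) n (v : 'I_n.+1 -> T) :
  vcons (v ord0) (v \o lift ord0) = v.
Proof.
by apply: functional_extensionality => i; rewrite /vcons; case: unliftP => [j|] ->.
Qed.

Fixpoint rename (L : language) n (phi : formula L n) :
    forall m, ('I_n -> 'I_m) -> formula L m :=
  match phi in formula _ n return forall m, ('I_n -> 'I_m) -> formula L m with
  | FBot _ => fun _ _ => FBot
  | FEq _ i j => fun _ s => FEq (s i) (s j)
  | FRel _ R t => fun _ s => FRel R (s \o t)
  | FImp _ phi psi => fun _ s => FImp (rename phi s) (rename psi s)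
  | FAll _ phi => fun _ s => FAll (rename phi (vcons ord0 (lift ord0 \o s)))
  end.

Lemma sat_rename (L : language) (M : structure L) n (phi : formula L n) m
    (s : 'I_n -> 'I_m) (v : 'I_m -> M) :
  sat (rename phi s) v <-> sat phi (v \o s).
Proof.
elim: phi m s v => //= {}n => [phi IH psi IH'|phi IH] m s v.
  by split=> H /IH /H /IH'.
have E x : vcons x v \o vcons ord0 (lift ord0 \o s) = vcons x (v \o s).
  by rewrite vcons_comp vcons0 compA vcons_lift.
by split=> H x; [rewrite -E; apply/IH | apply/IH; rewrite E].
Qed.

Definition FAnd (L : language) n (phi psi : formula L n) : formula L n :=
  FNot (FImp phi (FNot psi)).

Definition FEx (L : language) n (phi : formula L n.+1) : formula L n :=
  FNot (FAll (FNot phi)).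

Lemma sat_FAnd (L : language) (M : structure L) n (phi psi : formula L n)
    (v : 'I_n -> M) :
  sat (FAnd phi psi) v <-> sat phi v /\ sat psi v.
Proof.
split=> /= [H|[H1 H2] H]; last exact: (H H1 H2).
by apply: NNPP => N; apply: H => H1 H2; apply: N.
Qed.

Lemma sat_FEx (L : language) (M : structure L) n (phi : formula L n.+1)
    (v : 'I_n -> M) :
  sat (FEx phi) v <-> exists x, sat phi (vcons x v).
Proof.
split=> /= [H|[x Hx] H]; last exact: (H x Hx).
by apply: NNPP => N; apply: H => x Hx; apply: N; exists x.
Qed.

Fixpoint closure (L : language) n : formula L n -> sentence L :=
  match n return formula L n -> sentence L with
  | 0 => id
  | n.+1 => fun phi => closure (FAll phi)
  end.

Lemma sat_closure (L : language) (M : structure L) n (phi : formula L n) :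
  sat (closure phi) (@novar M) <-> forall v : 'I_n -> M, sat phi v.
Proof.
elim: n phi => [|n IH] phi /=.
  split=> // H v; suff -> : v = @novar M by [].
  by apply: functional_extensionality => -[].
split=> [/IH H v|H]; first by rewrite -(vcons_eta v); apply: H.
by apply/IH => v x; apply: H.
Qed.

Lemma sat_isomorphism (L : language) (M N : structure L) (f : M -> N)
    (iso : isomorphism f) n (phi : formula L n) (v : 'I_n -> M) :
  sat phi v <-> sat phi (f \o v).
Proof.
case: iso => bf pf; elim: phi v => //= {}n.
- by move=> i j v; split=> [->|/(bij_inj bf)].
- by move=> phi IH psi IH' v; split=> H /IH /H /IH'.
move=> phi IH v; split=> H x; last by apply/IH; rewrite vcons_comp.
by case: bf => g _ gK; rewrite -(gK x) -vcons_comp; apply/IH.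
Qed.

Lemma sat_quantifier_free (L : language) (M N : structure L) (f : M -> N)
    (emb : embedding f) n (phi : formula L n) (v : 'I_n -> M) :
  quantifier_free phi -> sat phi v <-> sat phi (f \o v).
Proof.
case: emb => inj pf; elim: phi v => //= {}n.
- by move=> i j v _; split=> [->|/inj].
move=> phi IH psi IH' v /andP[q q'].
by split=> H /(IH _ q) /H /(IH' _ q').
Qed.

Lemma sat_universal_down (L : language) (M N : structure L) (f : M -> N)
    (emb : embedding f) n (phi : formula L n) (v : 'I_n -> M) :
  universal phi -> sat phi (f \o v) -> sat phi v.
Proof.
elim: phi v => {}n; try by move=> *; apply/(sat_quantifier_free emb).
move=> phi IH v /= U H x; apply: IH => //.
by rewrite vcons_comp; apply: H.
Qed.

(** * Isolated tuples *)

Section Isolation.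

Variables (L : language) (M : structure L).

(** Isolation tested in M alone.  It agrees with isolation modulo the theory of
    M, since the universal closure of an implication between two formulas
    belongs to the theory as soon as it holds in M. *)
Definition isolated n (a : 'I_n -> M) :=
  exists2 phi : formula L n, sat phi a &
    forall psi, sat psi a -> forall b : 'I_n -> M, sat phi b -> sat psi b.

Lemma atomicP : atomic M <-> forall n (a : 'I_n -> M), isolated a.
Proof.
split=> H n a; have [phi] := H n a.
  by case=> Ha Hphi; exists phi => // psi Hpsi b; apply: (Hphi psi Hpsi M).
move=> Ha Hphi; exists phi; split=> // psi Hpsi N modN b.
have /modN/sat_closure/(_ b) : theory M (closure (FImp phi psi)) by
  apply/sat_closure => v; apply: Hphi.
exact.
Qed.

Lemma isolated_tail n (a : 'I_n.+1 -> M) :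
  isolated a -> isolated (a \o lift ord0).
Proof.
case=> phi Ha Hphi; exists (FEx phi).
  by apply/sat_FEx; exists (a ord0); rewrite vcons_eta.
move=> psi /sat_rename Hpsi b /sat_FEx[x /(Hphi _ Hpsi) /sat_rename].
by rewrite vcons_lift.
Qed.

Lemma isolated_rshift m n (a : 'I_(m + n) -> M) :
  isolated a -> isolated (a \o @rshift m n).
Proof.
elim: m a => [|m IH] a Ha.
  suff -> : a \o @rshift 0 n = a by [].
  by apply: functional_extensionality => i /=; congr a; apply: val_inj.
suff -> : a \o @rshift m.+1 n = (a \o lift ord0) \o @rshift m n.
  by apply/IH/isolated_tail.
by apply: functional_extensionality => i /=; congr a; apply: val_inj.
Qed.

(** Applied to negations, the inclusion of types gives its converse. *)
Lemma same_type n (a b : 'I_n -> M) :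
  (forall psi : formula L n, sat psi a -> sat psi b) ->
  forall psi : formula L n, sat psi a <-> sat psi b.
Proof.
move=> H psi; split; first exact: H.
by move=> Hb; apply: NNPP => Na; apply: (H (FNot psi)) Hb.
Qed.

End Isolation.

Lemma isomorphic_atomic (L : language) (M N : structure L) :
  isomorphic M N -> atomic N -> atomic M.
Proof.
case=> f iso /atomicP atN; apply/atomicP => n a.
have [phi Ha Hphi] := atN n (f \o a).
exists phi; first by apply/(sat_isomorphism iso).
move=> psi /(sat_isomorphism iso) Hpsi b /(sat_isomorphism iso) Hb.
by apply/(sat_isomorphism iso); apply: Hphi.
Qed.

(** * Strong substructures of a generic *)

Section Strong.

Variables (L : language) (K : preclass L) (M : structure L).
Hypothesis smoothK : smooth K.

(** The members of the chain are strong in M: a counterexample in M to a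
    universal formula with parameters in one member already appears in a later
    member, where the formula holds. *)
Lemma strong_cover n (v : 'I_n -> M) :
  strong_chain_union K M ->
  exists (A : structure L) (e : A -> M) (w : 'I_n -> A),
    strong_in K e /\ e \o w = v.
Proof.
case=> A [e [inK emb cover chain]].
pose later i m (phi : formula L m) (w : 'I_m -> A i) :=
  forall j (f : A i -> A j), i <= j -> strong K f ->
    (forall y, e j (f y) = e i y) -> sat phi (f \o w).
have limit0 i m (phi : formula L m) (w : 'I_m -> A i) :
    quantifier_free phi -> later i m phi w -> sat phi (e i \o w).
  move=> q H; have [f sf fe] := chain _ _ (leqnn i).
  have -> : e i \o w = e i \o (f \o w).
    by apply: functional_extensionality => k /=; rewrite fe.
  by apply/(sat_quantifier_free (emb i) _ q); apply: H.
have limit i m (phi : formula L m) (w : 'I_m -> A i) :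
    universal phi -> later i m phi w -> sat phi (e i \o w).
  elim: phi i w => {}m; try by move=> *; apply: limit0.
  move=> phi IH i w /= U H x; have [k [y <-]] := cover x.
  have [f sf fe] := chain _ _ (leq_maxl i k).
  have [g sg ge] := chain _ _ (leq_maxr i k).
  have -> : e i \o w = e (maxn i k) \o (f \o w).
    by apply: functional_extensionality => l /=; rewrite fe.
  rewrite -ge -vcons_comp; apply: IH => // j h le_j sh he.
  rewrite vcons_comp; apply: (H j (h \o f)).
  - exact: leq_trans (leq_maxl i k) le_j.
  - exact: (strong_trans smoothK) sf sh.
  - by move=> z /=; rewrite he fe.
have [s Hs] : exists s : 'I_n -> nat, forall k, exists y, e (s k) y = v k.
  by apply: (fin_all_exists (P := fun k i => exists y, e i y = v k)).
pose N := \max_k s k.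
have [w Hw] : exists w : 'I_n -> A N, forall k, e N (w k) = v k.
  apply: (fin_all_exists (P := fun k y => e N y = v k)) => k.
  have [y Hy] := Hs k.
  have [f _ fe] := chain _ _ (leq_bigmax k : s k <= N).
  by exists (f y); rewrite fe.
exists (A N), (e N), w; split; last exact: functional_extensionality.
split=> // m a enum_a phi Hphi.
apply: limit => [|j f _ sf _]; first exact: (Phi_universal smoothK) Hphi.
by apply: (proj1 (Phi_strong smoothK (inK N) enum_a (inK j)
  (strong_embedding smoothK sf))).
Qed.

(** Universal formulas pass from M down to B, so that a strong substructure of M
    is strong in every substructure of M in the class that contains it. *)
Lemma strong_factor (A B : structure L) (e : A -> M) (h : B -> M)
    (g : A -> B) :
  strong_in K e -> strong_in K h -> h \o g = e -> strong K g.
Proof.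
move=> [inA [inje pe] Phie] [inB embh _] hg.
have embg : embedding g.
  split=> [x y E|R t]; first by apply: inje; rewrite -hg /= E.
  apply: (iff_trans (pe R t)); rewrite -hg.
  by case: embh => _ ph; apply: iff_sym; apply: (ph R (g \o t)).
have [n [a enum_a]] := smooth_finite smoothK inA.
apply/(Phi_strong smoothK inA enum_a inB embg) => phi Hphi.
apply: (sat_universal_down embh); first exact: (Phi_universal smoothK) Hphi.
by rewrite compA hg; apply: Phie.
Qed.

(** Back and forth, by induction on the formula: an element x of M lies
    together with e(A) in some strong h(B), the inclusion of A in B is strong,
    and genericity provides a strong copy of B over e'(A). *)
Lemma generic_homogeneous n (phi : formula L n) (A : structure L)
    (e e' : A -> M) (w : 'I_n -> A) :
  generic K M -> strong_in K e -> strong_in K e' ->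
  sat phi (e \o w) -> sat phi (e' \o w).
Proof.
move=> [chain ext]; move: A e e' w.
suff H (A : structure L) (e e' : A -> M) (w : 'I_n -> A) :
    strong_in K e -> strong_in K e' -> sat phi (e \o w) <-> sat phi (e' \o w).
  by move=> A e e' w se se' /(H A e e' w se se').
elim: phi A e e' w => {}n.
- by [].
- move=> i j A e e' w [_ [inje _] _] [_ [inje' _] _] /=.
  by split=> [/inje ->|/inje' ->].
- move=> R t A e e' w [_ [_ pe] _] [_ [_ pe'] _].
  exact: (iff_trans (iff_sym (pe R (w \o t))) (pe' R (w \o t))).
- move=> phi IH psi IH' A e e' w se se' /=.
  by split=> H /(IH _ _ _ _ se se') /H /(IH' _ _ _ _ se se').
move=> phi IH A.
suff half (e e' : A -> M) (w : 'I_n -> A) : strong_in K e -> strong_in K e' ->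
    sat (FAll phi) (e' \o w) -> sat (FAll phi) (e \o w).
  by move=> e e' w se se'; split; apply: half.
move=> se se' H x; have [inA _ _] := se.
have [m [a enum_a]] := smooth_finite smoothK inA; have [b _ ab] := enum_a.
have [B [h [u [sh hu]]]] := strong_cover (vcons x (e \o a)) chain.
pose g := u \o lift ord0 \o b.
have hg : h \o g = e.
  have Ea : h \o u \o lift ord0 = e \o a by rewrite hu vcons_lift.
  apply: functional_extensionality => y.
  by have := congr1 (@^~ (b y)) Ea; rewrite /= ab.
have [inB _ _] := sh.
have [h' sh' hg'] := ext A B e' g inA inB se' (strong_factor se sh hg).
have <- : h (u ord0) = x.
  by have := congr1 (fun f => f ord0) hu; rewrite vcons0.
rewrite -hg -compA -vcons_comp; apply/(IH _ _ _ _ sh sh').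
rewrite vcons_comp; suff -> : h' \o (g \o w) = e' \o w by apply: H.
by apply: functional_extensionality => y /=; apply: hg'.
Qed.

(** The tuple u lists A, possibly with repetitions; the section r of u
    turns a tuple b of the same type into a copy of A.  The sets Phi_a, for
    all enumerations a of A, are read off the type of u after renaming
    the variables along r \o a. *)
Lemma strong_in_same_type (A : structure L) (e : A -> M) n (u : 'I_n -> A)
    (r : A -> 'I_n) (b : 'I_n -> M) :
  cancel r u -> strong_in K e ->
  (forall psi : formula L n, sat psi (e \o u) -> sat psi b) ->
  strong_in K (b \o r) /\ (b \o r) \o u = b.
Proof.
move=> rK [inA [inje pe] Phie] /same_type type_b; split; last first.
  apply: functional_extensionality => i /=.
  by apply/(type_b (FEq (r (u i)) i)); rewrite /= rK.
have Eb m (t : 'I_m -> A) (phi : formula L m) :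
    sat phi (e \o t) <-> sat phi ((b \o r) \o t).
  have := type_b (rename phi (r \o t)).
  suff -> : e \o t = (e \o u) \o (r \o t).
    by move=> H; split=> /sat_rename /H /sat_rename.
  by apply: functional_extensionality => i /=; rewrite rK.
split=> //; last by move=> m a enum_a phi Hphi; apply/Eb/Phie.
split=> [x y E|R t].
  by apply: inje; have /(type_b (FEq (r x) (r y))) := E; rewrite /= !rK.
exact: (iff_trans (pe R t) (Eb _ t (FRel R id))).
Qed.

End Strong.

(** * Merges *)

Lemma strong_in_merge (L1 L2 : language) (K1 : preclass L1) (K2 : preclass L2)
    (A M : structure (lang_union L1 L2)) (e : A -> M) :
  strong_in (merge K1 K2) e <->
  strong_in K1 (A := reduct1 A) (M := reduct1 M) e /\
  strong_in K2 (A := reduct2 A) (M := reduct2 M) e.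
Proof.
split=> [[[in1 in2] [inj /preserves_merge[p1 p2]] H]|].
  split; split=> // n a enum_a phi Hphi.
    by apply/sat_lift1; apply: (H n a) => //; left; exists phi.
  by apply/sat_lift2; apply: (H n a) => //; right; exists phi.
move=> [[in1 [inj p1] H1] [in2 [_ p2] H2]]; split=> //.
  by split=> //; apply/preserves_merge.
move=> n a enum_a phi [] [psi Hpsi ->].
  by apply/sat_lift1; apply: (H1 n a).
by apply/sat_lift2; apply: (H2 n a).
Qed.

Theorem corollary2p20 (L1 L2 : language)
    (K1 : preclass L1) (K2 : preclass L2)
    (M1 : structure L1) (M2 : structure L2)
    (Ms : structure (lang_union L1 L2))
    (smooth1 : smooth K1) (smooth2 : smooth K2)
    (generic1 : generic K1 M1) (generic2 : generic K2 M2)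
    (generic_merge : generic (merge K1 K2) Ms)
    (iso1 : isomorphic (reduct1 Ms) M1)
    (iso2 : isomorphic (reduct2 Ms) M2)
    (atomic1 : atomic M1) (atomic2 : atomic M2) :
  atomic Ms.
Proof.
have smoothK := merge_smooth smooth1 smooth2.
apply/atomicP => n c; have [chain _] := generic_merge.
have [A [e [c' [se <-]]]] := strong_cover smoothK c chain.
have [inA _ _] := se.
have [m [a [r ar ra]]] := smooth_finite smoothK inA.
(* The tuple must enumerate all of A, for its type to express that A is strong;
   the given tuple comes last, so that dropping initial coordinates leaves it. *)
pose u (i : 'I_(m + n)) := match split i with inl j => a j | inr j => c' j end.
have ur : cancel (@lshift m n \o r) u.
  by move=> x; rewrite /u /= (unsplitK (inl _)).
have -> : e \o c' = (e \o u) \o @rshift m n.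
  by apply: functional_extensionality => i; rewrite /u /= (unsplitK (inr _)).
apply: isolated_rshift.
have /atomicP/(_ _ (e \o u)) := isomorphic_atomic iso1 atomic1.
move=> [phi1 Hu1 Hphi1].
have /atomicP/(_ _ (e \o u)) := isomorphic_atomic iso2 atomic2.
move=> [phi2 Hu2 Hphi2].
exists (FAnd (lift1 L2 phi1) (lift2 L1 phi2)).
  by apply/sat_FAnd; split; [apply/sat_lift1 | apply/sat_lift2].
move=> psi Hpsi b /sat_FAnd[/sat_lift1 b1 /sat_lift2 b2].
have /strong_in_merge[se1 se2] := se.
have [sb1 Eb] := strong_in_same_type (A := reduct1 A)
  (M := reduct1 Ms) ur se1 (fun psi H => Hphi1 psi H b b1).
have [sb2 _] := strong_in_same_type (A := reduct2 A)
  (M := reduct2 Ms) ur se2 (fun psi H => Hphi2 psi H b b2).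
have sb : strong_in (merge K1 K2) (b \o (@lshift m n \o r)).
  by apply/strong_in_merge.
by rewrite -Eb; apply: (generic_homogeneous smoothK generic_merge se sb) Hpsi.
Qed.
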